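(* Let $k$ be a field with $\mathrm{char}(k)=2$, let $K$ be a nonrational function field of genus zero with full constant field $k$, let $\infty$ be a place of $K$ of degree $2$, let $\mathcal{C}$ be the ring of elements of $K$ integral outside $\infty$, and suppose that $\mathcal{C}$ is of type (ii), i.e. $\mathcal{C}=k[x,y]$ with $\nu(x)=\nu(y)=-1$ and $y^2+\rho x^2+\sigma=0$, $\rho,\sigma\in k^*$. Let $\Gamma=SL_2(\mathcal{C})$ and let $\mathcal{T}$ be the Bruhat-Tits tree of $GL_2(K_\infty)$. Then: (a) If $[k:k^2]=4$, then there is exactly one vertex in $\Gamma\backslash\mathcal{T}$ above $v_*$. (b) If $[k:k^2]>4$, then there are infinitely many vertices in $\Gamma\backslash\mathcal{T}$ above $v_*$. (c) In either case there are infinitely many edges between each such vertex and $v_0$.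
   Context: $K$ is an algebraic function field of one variable with full constant field $k$, of genus zero and nonrational (equivalently, with no place of degree $1$). $k^2$ is the subfield of squares of $k$. $\infty$ is a fixed place of degree $2$, $\nu$ its normalized discrete valuation, $\pi\in K$ a local parameter ($\nu(\pi)=1$), $\mathcal{O}$ the valuation ring of $\infty$ in $K$, $K_\infty$, $\mathcal{O}_\infty$ the completions. $\mathcal{C}=\{z\in K:\nu_P(z)\ge 0 \text{ for all places } P\ne\infty\}$, $G=GL_2(\mathcal{C})$. In the equation $y^2+\rho x^2+\sigma=0$, $\rho$ is a non-square in $k$ and the equation has no solutions in $k$. Put $t=y/x$. The tree $\mathcal{T}$: its vertices are the left cosets of $ZGL_2(\mathcal{O}_\infty)$ in $GL_2(K_\infty)$, $Z$ being the group of scalar matrices. Vertices $g_1ZGL_2(\mathcal{O}_\infty)$, $g_2ZGL_2(\mathcal{O}_\infty)$ are adjacent iff $g_2^{-1}g_1\in \begin{pmatrix}\pi & z\\0&1\end{pmatrix}ZGL_2(\mathcal{O}_\infty)$ for some $z\in\mathcal{O}$, or $g_2^{-1}g_1\in\begin{pmatrix}\pi^{-1}&0\\0&1\end{pmatrix}ZGL_2(\mathcal{O}_\infty)$. $v(\pi^n,z)$ is the vertex represented by $\begin{pmatrix}\pi^n&z\\0&1\end{pmatrix}$. $G$ acts on $\mathcal{T}$ by left multiplication, without inversion. Put $v_*=v(\pi,t)$, $v_n=v(\pi^{-n},0)$ ($n\ge0$). The quotient graph $G\backslash\mathcal{T}$ is identified with the infinite path $v_*,v_0,v_1,v_2,\dots$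 (each $G$-orbit of vertices or edges of $\mathcal{T}$ meets this path exactly once). Let $\phi:\Gamma\backslash\mathcal{T}\to G\backslash\mathcal{T}$ be the natural epimorphism of graphs; a vertex (or edge) of $\Gamma\backslash\mathcal{T}$ is ''above'' $w$ if $\phi$ maps it to $w$. There is exactly one vertex of $\Gamma\backslash\mathcal{T}$ above $v_0$, again denoted $v_0$. Quotient graphs may have multiple edges. *)

(* Defs.v *)
From HB Require Import structures.
From mathcomp Require Import all_boot all_order all_algebra.
From mathcomp Require Import boolp classical_sets functions cardinality fsbigop.

Set Implicit Arguments.
Unset Strict Implicit.
Unset Printing Implicit Defensive.

Import Order.TTheory GRing.Theory Num.Theory.
Local Open Scope classical_set_scope.
Local Open Scope ring_scope.

Section Dimension.
Variables (L : fieldType).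

(* For a subfield S of L and S-subspaces W <= U of L: the S-vector space U / W
   has dimension d. *)
Definition has_dim (S U W : set L) (d : nat) : Prop :=
  exists2 b : 'I_d -> L, (forall i, U (b i)) &
    forall z, U z -> exists! c : {ffun 'I_d -> L},
      (forall i, S (c i)) /\ W (z - \sum_(i < d) c i * b i).

(* Meaningful for finite-dimensional U / W; it is 0 otherwise. *)
Definition dim (S U W : set L) : nat := xget 0%N [set d | has_dim S U W d].

(* [U / W : S] > n, the infinite-dimensional case included. *)
Definition dim_gt (S U W : set L) (n : nat) : Prop :=
  forall d, has_dim S U W d -> (n < d)%N.

Definition squares : set L := [set a ^+ 2 | a in setT].

End Dimension.

Arguments squares : clear implicits.

Section Valuation.
Variable F : fieldType.

(* Normalized discrete valuations. The value +oo at 0 is replaced by the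
   default 0, so that a valuation is determined by its values on F^*. *)
Definition is_valuation (v : F -> int) : Prop :=
  [/\ v 0 = 0,
      forall a b : F, a != 0 -> b != 0 -> v (a * b) = v a + v b,
      forall a b : F, a != 0 -> b != 0 -> a + b != 0 ->
        Num.min (v a) (v b) <= v (a + b) &
      exists2 a : F, a != 0 & v a = 1].

(* v z >= n, with v 0 read as +oo. *)
Definition vge (v : F -> int) (n : int) : set F :=
  [set z | z = 0 \/ n <= v z].

Definition valuation_ring (v : F -> int) : set F := vge v 0.
Definition maximal_ideal (v : F -> int) : set F := vge v 1.

Definition complete (v : F -> int) : Prop :=
  forall u : nat -> F,
    (forall n : int, exists N, forall i i',
       (N <= i)%N -> (N <= i')%N -> vge v n (u i - u i')) ->
    exists l, forall n : int, exists N, forall i,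
      (N <= i)%N -> vge v n (u i - l).

End Valuation.

(* The field E with the embedding j and the valuation w is a completion of
   F with respect to v (which determines (E, j, w) up to isomorphism). *)
Definition is_completion (F E : fieldType) (v : F -> int)
    (j : {rmorphism F -> E}) (w : E -> int) : Prop :=
  [/\ is_valuation w,
      forall a, w (j a) = v a,
      forall z (n : int), exists a, vge w n (z - j a) &
      complete w].

Section FunctionField.
Variables (k K : fieldType) (iota : {rmorphism k -> K}).

Definition constants : set K := range iota.

(* The subfield k(x). *)
Definition simple_subfield (x : K) : set K :=
  [set z | exists p q : {poly k}, (map_poly iota q).[x] != 0 /\
     z = (map_poly iota p).[x] / (map_poly iota q).[x]].

(* The subring k[x, y]. *)
Definition poly_subring (x y : K) : set K :=
  [set z | exists p : {poly {poly k}},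
     z = (map_poly (map_poly iota) p).[y%:P].[x]].

Definition is_function_field : Prop :=
  exists x, ~ algebraicOver iota x /\
    exists d, has_dim (simple_subfield x) setT [set 0] d.

Definition full_constant_field : Prop :=
  forall z, algebraicOver iota z -> constants z.

Definition rational : Prop :=
  exists x, ~ algebraicOver iota x /\ simple_subfield x = setT.

(* A place is represented by its normalized discrete valuation. *)
Definition places : set (K -> int) :=
  [set v | is_valuation v /\ forall c, v (iota c) = 0].

Definition place_degree (v : K -> int) : nat :=
  dim constants (valuation_ring v) (maximal_ideal v).

(* Only the values of a divisor at places are relevant. *)
Definition is_divisor (D : (K -> int) -> int) : Prop :=
  finite_set [set v | places v /\ D v != 0].

Definition divisor_degree (D : (K -> int) -> int) : int :=
  \sum_(v \in places) (D v * (place_degree v)%:Z).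

Definition RR_space (D : (K -> int) -> int) : set K :=
  [set z | forall v, places v -> vge v (- D v) z].

Definition RR_dim (D : (K -> int) -> int) : nat :=
  dim constants (RR_space D) [set 0].

(* The genus is the maximum of deg D - l(D) + 1 over all divisors D. *)
Definition has_genus (g : nat) : Prop :=
  (forall D, is_divisor D ->
     divisor_degree D - (RR_dim D)%:Z + 1 <= g%:Z) /\
  (exists2 D, is_divisor D & divisor_degree D - (RR_dim D)%:Z + 1 = g%:Z).

(* The ring of elements of K that are integral outside the place nu. *)
Definition integral_outside (nu : K -> int) : set K :=
  [set z | forall v, places v -> v <> nu -> valuation_ring v z].

Definition type_ii (nu : K -> int) (x y : K) (rho sigma : k) : Prop :=
  [/\ integral_outside nu = poly_subring x y,
      nu x = -1 /\ nu y = -1,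
      y ^+ 2 + iota rho * x ^+ 2 + iota sigma = 0,
      rho != 0 /\ sigma != 0 &
      (forall a, a ^+ 2 <> rho) /\
      (forall a b, b ^+ 2 + rho * a ^+ 2 + sigma <> 0)].

End FunctionField.

Section LinearGroups.
Variable F : fieldType.

(* GL_2(A) and SL_2(A) for a subring A of F. *)
Definition GL2 (A : set F) : set 'M[F]_2 :=
  [set g : 'M[F]_2 | [/\ g \in unitmx, forall i j, A (g i j) &
                             forall i j, A (invmx g i j)]].

Definition SL2 (A : set F) : set 'M[F]_2 :=
  [set g : 'M[F]_2 | (forall i j, A (g i j)) /\ \det g = 1].

(* The matrix (a b; 0 1). *)
Definition affine_mx (a b : F) : 'M[F]_2 :=
  \matrix_(i, j) nth 0 (nth [::] [:: [:: a; b]; [:: 0; 1]] i) j.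

Definition left_coset (H : set 'M[F]_2) (g : 'M[F]_2) : set 'M[F]_2 :=
  [set g *m h | h in H].

(* Left multiplication on subsets of M_2(F), and on sets of such subsets. *)
Definition act (g : 'M[F]_2) (V : set 'M[F]_2) : set 'M[F]_2 :=
  [set g *m m | m in V].

Definition act_edge (g : 'M[F]_2) (e : set (set 'M[F]_2)) :
  set (set 'M[F]_2) := [set act g V | V in e].

Definition vertex_orbit (H V : set 'M[F]_2) : set (set 'M[F]_2) :=
  [set act h V | h in H].

Definition edge_orbit (H : set 'M[F]_2) (e : set (set 'M[F]_2)) :
  set (set (set 'M[F]_2)) := [set act_edge h e | h in H].

End LinearGroups.

Section Tree.
(* (E, j, w) is a completion of K at the place nu, with local parameter pi. *)
Variables (K E : fieldType) (nu : K -> int) (pi : K).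
Variables (j : {rmorphism K -> E}) (w : E -> int).

(* Z GL_2(O_oo). *)
Definition ZGL2O : set 'M[E]_2 :=
  [set m | exists c h, [/\ c != 0, GL2 (valuation_ring w) h & m = c *: h]].

Definition vertices : set (set 'M[E]_2) :=
  [set left_coset ZGL2O g | g in [set g : 'M[E]_2 | g \in unitmx]].

Definition adjacent (V1 V2 : set 'M[E]_2) : Prop :=
  exists g1 g2 : 'M[E]_2,
    [/\ g1 \in unitmx, g2 \in unitmx,
        V1 = left_coset ZGL2O g1, V2 = left_coset ZGL2O g2 &
        (exists2 z, valuation_ring nu z &
           left_coset ZGL2O (affine_mx (j pi) (j z)) (invmx g2 *m g1)) \/
        left_coset ZGL2O (affine_mx (j pi^-1) 0) (invmx g2 *m g1)].

(* The vertex v(a, z). *)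
Definition vertex (a z : K) : set 'M[E]_2 :=
  left_coset ZGL2O (affine_mx (j a) (j z)).

Definition vstar (t : K) : set 'M[E]_2 := vertex pi t.
Definition vpath (n : nat) : set 'M[E]_2 := vertex (pi ^- n) 0.

(* Subgroups of GL_2(K) act through j. *)
Definition embed (H : set 'M[K]_2) : set 'M[E]_2 :=
  [set map_mx j g | g in H].

Definition quotient_vertices (H : set 'M[E]_2) : set (set (set 'M[E]_2)) :=
  [set vertex_orbit H V | V in vertices].

(* The map H\T -> G\T on vertices, for H <= G: H V is sent to G V. *)
Definition phi (G : set 'M[E]_2) (X : set (set 'M[E]_2)) :
  set (set 'M[E]_2) := [set act g V | g in G & V in X].

(* The vertices of H\T above the vertex G V of G\T. *)
Definition vertices_above (H G : set 'M[E]_2) (V : set 'M[E]_2) :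
  set (set (set 'M[E]_2)) :=
  [set X | quotient_vertices H X /\ phi G X = vertex_orbit G V].

(* The edges of the multigraph H\T (the H-orbits of unoriented edges {V1, V2}
   of T) with end points X1 and X2. *)
Definition edges_between (H : set 'M[E]_2) (X1 X2 : set (set 'M[E]_2)) :
  set (set (set (set 'M[E]_2))) :=
  [set e | exists V1 V2, [/\ adjacent V1 V2, X1 = vertex_orbit H V1,
             X2 = vertex_orbit H V2 & e = edge_orbit H [set V1; V2]]].

End Tree.

(* Main.v *)
(* Gamma is the kernel of det on G. Hence, if V and W are the stabilizers in G of
   v_* and of the edge from v_* to v_0, the vertices of Gamma\T above v_* are in
   bijection with the cosets of det V in the multiplicative group of k, and the
   edges from each of them to v_0 with the cosets of det W in det V. The elements
   of V are the matrices ((e, rho z), (z, e)) with z = b + c x + d y and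
   e = a + d rho x + c y, of determinant
   a^2 + rho b^2 + sigma c^2 + rho sigma d^2; those of W have c = d = 0. Thus
   det V and det W are the multiplicative groups of k^2(rho, sigma) and k^2(rho),
   fields of degrees 4 and 2 over k^2. If a is not in a subfield of k that
   contains k^2, then the elements a + u^2, for u in k, lie in distinct cosets
   of its multiplicative group. *)
Require Import Defs.
From HB Require Import structures.
From mathcomp Require Import all_boot all_order all_algebra.
From mathcomp Require Import boolp classical_sets functions cardinality fsbigop.
From mathcomp Require Import zify ring.

Set Implicit Arguments.
Unset Strict Implicit.
Unset Printing Implicit Defensive.

Import Order.TTheory GRing.Theory Num.Theory.
Local Open Scope classical_set_scope.
Local Open Scope ring_scope.

(** * Subrings of a field and the groups GL_2, SL_2 over them *)

Section Subring.
Variables (F : fieldType) (A : set F).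

Definition is_subring : Prop :=
  [/\ A 1, forall a b, A a -> A b -> A (a - b)
        & forall a b, A a -> A b -> A (a * b)].

Hypothesis Aring : is_subring.

Lemma subring1 : A 1. Proof. by case: Aring. Qed.

Lemma subringB a b : A a -> A b -> A (a - b).
Proof. by case: Aring => _ H _; apply: H. Qed.

Lemma subringM a b : A a -> A b -> A (a * b).
Proof. by case: Aring => _ _; apply. Qed.

Lemma subring0 : A 0.
Proof. by rewrite -(subrr 1); apply: subringB; apply: subring1. Qed.

Lemma subringN a : A a -> A (- a).
Proof. by move=> Aa; rewrite -sub0r; apply/subringB => //; apply: subring0. Qed.

Lemma subringD a b : A a -> A b -> A (a + b).
Proof. by move=> Aa Ab; rewrite -[b]opprK; apply/subringB/subringN. Qed.

Lemma subringX a n : A a -> A (a ^+ n).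
Proof.
move=> Aa; elim: n => [|n IHn]; first exact: subring1.
by rewrite exprS; apply: subringM.
Qed.

Lemma subring_sum (I : Type) (r : seq I) (P : pred I) (f : I -> F) :
  (forall i, A (f i)) -> A (\sum_(i <- r | P i) f i).
Proof.
by move=> Af; elim/big_ind: _ => //; [apply: subring0 | apply: subringD].
Qed.

Lemma subring_prod (I : Type) (r : seq I) (P : pred I) (f : I -> F) :
  (forall i, A (f i)) -> A (\prod_(i <- r | P i) f i).
Proof.
by move=> Af; elim/big_ind: _ => //; [apply: subring1 | apply: subringM].
Qed.

Lemma subring_mulmx n (g h : 'M[F]_n) :
  (forall i l, A (g i l)) -> (forall i l, A (h i l)) ->
  forall i l, A ((g *m h) i l).
Proof.
move=> Ag Ah i l; rewrite mxE.
by apply: subring_sum => m; apply: subringM.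
Qed.

Lemma subring_det n (g : 'M[F]_n) : (forall i l, A (g i l)) -> A (\det g).
Proof.
move=> Ag; apply: subring_sum => s; apply: subringM.
  by apply: subringX; apply/subringN/subring1.
exact: subring_prod.
Qed.

(** By the cofactor formula, the entries of the inverse lie in [A] as soon as the inverse of the
    determinant does. *)
Lemma GL2_det (g : 'M[F]_2) :
  GL2 A g <-> [/\ g \in unitmx, forall i l, A (g i l) & A (\det g)^-1].
Proof.
split=> [[gU Ag Ag'] | [gU Ag Ad]]; split=> //.
  by rewrite -det_inv; apply: subring_det.
move=> i l; rewrite /invmx gU !mxE; apply: subringM => //.
rewrite /cofactor; apply: subringM.
  by apply: subringX; apply/subringN/subring1.
by apply: subring_det => i' l'; rewrite !mxE.
Qed.

Lemma GL2_1 : GL2 A 1%:M.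
Proof.
have A1 i l : A ((1%:M : 'M[F]_2) i l).
  by rewrite mxE; case: eqP => _; [apply: subring1 | apply: subring0].
by split; [apply: unitmx1 | | rewrite invmx1].
Qed.

Lemma GL2_M g h : GL2 A g -> GL2 A h -> GL2 A (g *m h).
Proof.
move=> [gU Ag Ag'] [hU Ah Ah']; have ghU : g *m h \in unitmx.
  by rewrite unitmx_mul gU.
split=> //; first exact: subring_mulmx.
have -> : invmx (g *m h) = invmx h *m invmx g.
  by rewrite -[RHS]mul1mx -(mulVmx ghU) -!mulmxA (mulmxA h) mulmxV // mul1mx
     mulmxV // mulmx1.
exact: subring_mulmx.
Qed.

Lemma GL2_V g : GL2 A g -> GL2 A (invmx g).
Proof. by move=> [gU Ag Ag']; split; rewrite ?unitmx_inv ?invmxK. Qed.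

Lemma SL2_GL2 g : SL2 A g <-> GL2 A g /\ \det g = 1.
Proof.
split=> [[Ag dg]|[[]]] //; split=> //; apply/GL2_det.
by split; rewrite ?unitmxE ?dg ?unitr1 ?invr1 //; apply: subring1.
Qed.

End Subring.

(** * Explicit formulas for 2 x 2 matrices *)

Lemma forall_I2 (P : 'I_2 -> Prop) : P 0 -> P 1 -> forall i, P i.
Proof.
move=> P0 P1 [[|[|]]] // lt_i.
  by have -> : Ordinal lt_i = 0 by apply: val_inj.
by have -> : Ordinal lt_i = 1 by apply: val_inj.
Qed.

Lemma mx22P (F : nmodType) (g h : 'M[F]_2) :
  g 0 0 = h 0 0 -> g 0 1 = h 0 1 -> g 1 0 = h 1 0 -> g 1 1 = h 1 1 -> g = h.
Proof.
by move=> h00 h01 h10 h11; apply/matrixP; apply: forall_I2; apply: forall_I2.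
Qed.

Lemma det_mx2E (F : comNzRingType) (g : 'M[F]_2) :
  \det g = g 0 0 * g 1 1 - g 0 1 * g 1 0.
Proof.
rewrite (expand_det_row g 0) !big_ord_recl big_ord0 /cofactor !det_mx11 !mxE.
have -> : lift 0 0 = 1 :> 'I_2 by apply: val_inj.
have -> : lift 1 0 = 0 :> 'I_2 by apply: val_inj.
by rewrite /= addr0 expr0 expr1 mul1r mulN1r mulrN.
Qed.

Lemma mulmx2E (F : nzSemiRingType) (g h : 'M[F]_2) i l :
  (g *m h) i l = g i 0 * h 0 l + g i 1 * h 1 l.
Proof.
rewrite mxE !big_ord_recl big_ord0 addr0.
by have -> : lift 0 0 = 1 :> 'I_2 by apply: val_inj.
Qed.

Lemma affine_mxE (F : fieldType) (a b : F) :
  (affine_mx a b 0 0 = a) * (affine_mx a b 0 1 = b) *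
  (affine_mx a b 1 0 = 0) * (affine_mx a b 1 1 = 1).
Proof. by do ![split]; rewrite mxE. Qed.

Lemma det_affine (F : fieldType) (a b : F) : \det (affine_mx a b) = a.
Proof. by rewrite det_mx2E !affine_mxE mulr1 mulr0 subr0. Qed.

Lemma unitmx_affine (F : fieldType) (a b : F) :
  (affine_mx a b \in unitmx) = (a != 0).
Proof. by rewrite unitmxE det_affine unitfE. Qed.

Lemma map_affine (F F' : fieldType) (j : {rmorphism F -> F'}) (a b : F) :
  map_mx j (affine_mx a b) = affine_mx (j a) (j b).
Proof. by apply: mx22P; rewrite mxE !affine_mxE ?rmorph0 ?rmorph1. Qed.

(** * Discrete valuations *)

Section ValuationTheory.
Variables (F : fieldType) (v : F -> int).
Hypothesis vP : is_valuation v.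

Lemma valuationM a b : a != 0 -> b != 0 -> v (a * b) = v a + v b.
Proof. by case: vP => _ H _ _; apply: H. Qed.

Lemma valuation0 : v 0 = 0. Proof. by case: vP. Qed.

Lemma valuation1 : v 1 = 0.
Proof.
have := valuationM (oner_neq0 F) (oner_neq0 F).
by rewrite mulr1; move: (v 1) => n; lia.
Qed.

Lemma valuationN a : v (- a) = v a.
Proof.
have [->|a0] := eqVneq a 0; first by rewrite oppr0.
have N10 : (-1 : F) != 0 by rewrite oppr_eq0 oner_neq0.
have vN1 : v (-1) = 0.
  have := valuationM N10 N10.
  by rewrite mulrNN mulr1 valuation1; move: (v _) => n; lia.
by rewrite -mulN1r valuationM // vN1 add0r.
Qed.

Lemma valuationV a : v a^-1 = - v a.
Proof.
have [->|a0] := eqVneq a 0; first by rewrite invr0 valuation0.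
by have := valuationM a0 (invr_neq0 a0); rewrite divff // valuation1; lia.
Qed.

Lemma valuationX a n : v (a ^+ n) = v a * n%:Z.
Proof.
have [->|a0] := eqVneq a 0.
  case: n => [|n]; first by rewrite expr0 valuation1 mulr0.
  by rewrite expr0n /= valuation0 mul0r.
elim: n => [|n IHn]; first by rewrite expr0 valuation1 mulr0.
by rewrite exprS valuationM ?expf_neq0 // IHn; lia.
Qed.

Lemma vge0 n : vge v n 0. Proof. by left. Qed.

Lemma vge_val n a : n <= v a -> vge v n a. Proof. by right. Qed.

Lemma vgeP n a : a != 0 -> vge v n a -> n <= v a.
Proof. by move=> a0 [a0'|//]; rewrite a0' eqxx in a0. Qed.

Lemma vgeW n m a : vge v n a -> m <= n -> vge v m a.
Proof. by move=> [->|na] mn; [left | right; apply: le_trans na]. Qed.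

Lemma vgeD n a b : vge v n a -> vge v n b -> vge v n (a + b).
Proof.
move=> [->|na]; first by rewrite add0r.
move=> [->|nb]; first by rewrite addr0; right.
have [->|a0] := eqVneq a 0; first by rewrite add0r; right.
have [->|b0] := eqVneq b 0; first by rewrite addr0; right.
have [->|ab0] := eqVneq (a + b) 0; [by left | right].
have [_ _ H _] := vP; apply: le_trans (H _ _ a0 b0 ab0).
by rewrite le_min na.
Qed.

Lemma vgeN n a : vge v n a -> vge v n (- a).
Proof.
by move=> [->|na]; [left; rewrite oppr0 | right; rewrite valuationN].
Qed.

Lemma vgeB n a b : vge v n a -> vge v n b -> vge v n (a - b).
Proof. by move=> na nb; apply/vgeD/vgeN. Qed.

Lemma vgeM n m a b : vge v n a -> vge v m b -> vge v (n + m) (a * b).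
Proof.
have [->|a0 /(vgeP a0) na] := eqVneq a 0; first by left; rewrite mul0r.
have [->|b0 /(vgeP b0) mb] := eqVneq b 0; first by left; rewrite mulr0.
by right; rewrite valuationM // lerD.
Qed.

Lemma vge_subring : is_subring (valuation_ring v).
Proof.
split; first by right; rewrite valuation1.
- by move=> a b; apply: vgeB.
- by move=> a b /vgeM H /H.
Qed.

End ValuationTheory.

(** * Cosets of Z GL_2(O_oo) and the action on vertices *)

Section Cosets.
Variables (E : fieldType) (w : E -> int).
Hypothesis wP : is_valuation w.
Let O := valuation_ring w.
Let Oring : is_subring O := vge_subring wP.
Let H := ZGL2O w.

Lemma ZGL2O_1 : H 1%:M.
Proof.
exists 1, 1%:M; split; rewrite ?oner_neq0 ?scale1r //; exact: GL2_1.
Qed.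

Lemma ZGL2O_GL2 g : GL2 O g -> H g.
Proof. by move=> Og; exists 1, g; split; rewrite ?oner_neq0 ?scale1r. Qed.

Lemma ZGL2O_M g h : H g -> H h -> H (g *m h).
Proof.
move=> [c [g' [c0 Og ->]]] [d [h' [d0 Oh ->]]].
exists (c * d), (g' *m h'); split; rewrite ?mulf_neq0 //.
  exact: GL2_M.
by rewrite -scalemxAl -scalemxAr scalerA.
Qed.

Lemma ZGL2O_V g : H g -> H (invmx g).
Proof.
move=> [c [g' [c0 Og ->]]]; exists c^-1, (invmx g'); split.
- by rewrite invr_neq0.
- exact: GL2_V.
- by rewrite invmxZ // unitmxZ ?unitfE //; case: Og.
Qed.

Lemma GL2O_det g : GL2 O g -> w (\det g) = 0.
Proof.
move=> Og; have /(GL2_det Oring)[gU _ Odi] := Og.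
have [_ Og' _] := Og; have Od := subring_det Oring Og'.
have d0 : \det g != 0 by rewrite -unitfE -unitmxE.
have := vgeP (invr_neq0 d0) Odi; have := vgeP d0 Od; rewrite valuationV //; lia.
Qed.

(** Here [n] is the valuation of the scalar factor. The parity of the valuation of the determinant
    will separate v_* from v_0, and a determinant of valuation 0 will force integral entries. *)
Lemma ZGL2O_val g : H g ->
  exists n : int, w (\det g) = 2 * n /\ forall i l, vge w n (g i l).
Proof.
move=> [c [h [c0 Oh ->]]]; exists (w c); split.
  have d0 : \det h != 0 by rewrite -unitfE -unitmxE; case: Oh.
  by rewrite detZ valuationM ?expf_neq0 // valuationX // GL2O_det //; lia.
move=> i l; rewrite mxE -[w c]addr0; apply: vgeM => //; first exact: vge_val.
by case: Oh => _ Oh _; apply: Oh.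
Qed.

Lemma act_coset g m : act g (left_coset H m) = left_coset H (g *m m).
Proof.
rewrite /act /left_coset image_comp; apply: eq_imagel => h _ /=.
by rewrite mulmxA.
Qed.

Lemma coset_eq g h : g \in unitmx -> h \in unitmx ->
  (left_coset H g = left_coset H h) <-> H (invmx h *m g).
Proof.
move=> gU hU; split=> [E1|Hgh].
  have : left_coset H g g by exists 1%:M; [exact: ZGL2O_1 | rewrite mulmx1].
  by rewrite E1 => -[m Hm <-]; rewrite mulKmx.
apply/seteqP; split=> _ [m Hm <-].
  exists (invmx h *m g *m m); first exact: ZGL2O_M.
  by rewrite !mulmxA mulmxV // mul1mx.
exists (invmx g *m h *m m); last by rewrite !mulmxA mulmxV // mul1mx.
apply: ZGL2O_M => //; have -> : invmx g *m h = invmx (invmx h *m g).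
  have U : invmx h *m g \in unitmx by rewrite unitmx_mul unitmx_inv hU.
  rewrite -[RHS]mul1mx -(mulVmx gU) -mulmxA; congr (_ *m _).
  by rewrite -[in LHS](mulmx1 h) -(mulmxV U) !mulmxA mulmxV // mul1mx.
exact: ZGL2O_V.
Qed.

End Cosets.

Lemma actM (F : fieldType) (g h : 'M[F]_2) V : act g (act h V) = act (g *m h) V.
Proof.
rewrite /act image_comp; apply: eq_imagel => m _ /=.
by rewrite mulmxA.
Qed.

Lemma act1 (F : fieldType) (V : set 'M[F]_2) : act 1%:M V = V.
Proof.
by apply/seteqP; split=> [_ [m Vm <-]|m Vm]; [|exists m]; rewrite ?mul1mx.
Qed.

Lemma act_pair (F : fieldType) (g : 'M[F]_2) V W :
  act_edge g [set V; W] = [set act g V; act g W].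
Proof. by rewrite /act_edge image_setU !image_set1. Qed.

(** * The ring C = k[x, y] and its filtration by the pole order at oo *)

Section Conic.
Variables (k K : fieldType) (iota : {rmorphism k -> K}) (nu : K -> int).
Variables (x y : K) (rho sigma : k).
Hypothesis char_k : 2%N \in [pchar k].
Hypothesis nu_place : places iota nu.
Hypothesis C_type_ii : type_ii iota nu x y rho sigma.

Let C := integral_outside iota nu.
Let t := y / x.

Let nuP : is_valuation nu. Proof. by case: nu_place. Qed.

Lemma conic_char : 2%N \in [pchar K]. Proof. exact: rmorph_pchar char_k. Qed.

Lemma nu_iota a : nu (iota a) = 0. Proof. by case: nu_place. Qed.

Lemma vge_iota a : vge nu 0 (iota a).
Proof. by apply: vge_val; rewrite nu_iota. Qed.

Lemma conic_x_neq0 : x != 0.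
Proof.
by apply/eqP=> x0; case: C_type_ii => _ [+ _] _ _; rewrite x0 valuation0.
Qed.

Lemma conic_y_neq0 : y != 0.
Proof.
by apply/eqP=> y0; case: C_type_ii => _ [_ +] _ _; rewrite y0 valuation0.
Qed.

Lemma vge_x : vge nu (-1) x.
Proof. by apply: vge_val; case: C_type_ii => _ [-> _]. Qed.

Lemma vge_y : vge nu (-1) y.
Proof. by apply: vge_val; case: C_type_ii => _ [_ ->]. Qed.

Lemma vge_invx : vge nu 1 x^-1.
Proof.
by apply: vge_val; rewrite valuationV //; case: C_type_ii => _ [-> _].
Qed.

Lemma nu_t : nu t = 0.
Proof.
rewrite /t valuationM ?invr_neq0 ?conic_x_neq0 ?conic_y_neq0 // valuationV //.
by case: C_type_ii => _ [-> ->].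
Qed.

Lemma vge_t : vge nu 0 t.
Proof. by apply: vge_val; rewrite nu_t. Qed.

Lemma conic_tx : t * x = y.
Proof. by rewrite /t divfK // conic_x_neq0. Qed.

Lemma conic_eq : y ^+ 2 = iota rho * x ^+ 2 + iota sigma.
Proof.
case: C_type_ii => _ _ /eqP + _ _; rewrite -addrA addr_eq0 => /eqP ->.
exact: oppr_pchar2 conic_char _.
Qed.

(** This is the conic equation divided by [x]. It splits [t * y] into an element of C and a term of
    positive valuation. *)
Lemma conic_ty : t * y = iota rho * x + iota sigma * x^-1.
Proof.
have x0 := conic_x_neq0.
apply: (mulIf x0); rewrite mulrAC conic_tx -expr2 conic_eq; by field.
Qed.

(** Since [x^-1] has positive valuation, the residue of [t] is a square root of [rho]. *)
Lemma conic_t2 : t ^+ 2 = iota rho + iota sigma * x^-1 * x^-1.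
Proof.
have x0 := conic_x_neq0.
apply: (mulIf x0); have -> : t ^+ 2 * x = t * (t * x) by ring.
by rewrite conic_tx conic_ty; field.
Qed.

(* Squaring is additive in characteristic 2, so the square of a combination of
   positive valuation has a constant term of positive valuation, hence zero. *)
Lemma residue_free a b : vge nu 1 (iota a + iota b * t) -> a = 0 /\ b = 0.
Proof.
move=> ab1; have := vgeM nuP ab1 ab1; rewrite -expr2.
rewrite sqrrD mulr2n (addrr_pchar2 conic_char) addr0 exprMn conic_t2.
rewrite -!rmorphXn mulrDr addrA -rmorphM => S1.
have {S1} : vge nu 1 (iota (a ^+ 2 + b ^+ 2 * rho)).
  rewrite -[iota _](addrK (iota (b ^+ 2) * (iota sigma * x^-1 * x^-1))).
  rewrite rmorphD; apply: vgeB => //; first by apply: vgeW S1 _.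
  rewrite mulrA -[1]addr0; apply: vgeM => //; last first.
    by apply: vgeW vge_invx _.
  rewrite -[1]add0r mulrA -rmorphM; apply: vgeM => //.
    exact: vge_iota.
  exact: vge_invx.
case; last by rewrite nu_iota.
move=> /eqP; rewrite fmorph_eq0 => /eqP E.
have [b0|b0] := eqVneq b 0.
  move: E; rewrite b0 expr0n mul0r addr0 => /eqP.
  by rewrite expf_eq0 => /eqP.
case: C_type_ii => _ _ _ _ [/(_ (a / b)) []].
rewrite expr_div_n; apply: (mulIf (expf_neq0 2 b0)).
rewrite divfK ?expf_neq0 // mulrC; apply/eqP.
by rewrite -subr_eq0 (GRing.subr_pchar2 char_k) E.
Qed.

Lemma integral_outside_subring : is_subring C.
Proof.
split; first by move=> v [vP _] _; apply: subring1; apply: vge_subring.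
- move=> a b Ca Cb v vp vnu; have [vP _] := vp.
  by apply: (subringB (vge_subring vP)); [apply: Ca | apply: Cb].
- move=> a b Ca Cb v vp vnu; have [vP _] := vp.
  by apply: (subringM (vge_subring vP)); [apply: Ca | apply: Cb].
Qed.

Lemma integral_outside_const a : C (iota a).
Proof. by move=> v [_ vi] _; right; rewrite vi. Qed.

Lemma integral_outsideE : C = poly_subring iota x y.
Proof. by case: C_type_ii. Qed.

Let CR := integral_outside_subring.

Lemma conic_x_integral : C x.
Proof.
rewrite integral_outsideE; exists ('X%:P); rewrite map_polyC hornerC /=.
by rewrite map_polyX hornerX.
Qed.

Lemma conic_y_integral : C y.
Proof.
by rewrite integral_outsideE; exists 'X; rewrite map_polyX hornerX hornerC.
Qed.

Lemma conic_linear_integral b c : C (iota b * x + iota c * y).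
Proof.
apply: (subringD CR); apply: (subringM CR (integral_outside_const _)).
  exact: conic_x_integral.
exact: conic_y_integral.
Qed.

(** The conic equation reduces a polynomial in x, y to the form p(x) + r(x) y, and y = t x turns the
    second summand into (r X)(x) t. This is why the constant coefficient of [q] vanishes. *)
Lemma conic_expand z : C z -> exists p q : {poly k},
  q`_0 = 0 /\ z = (map_poly iota p).[x] + (map_poly iota q).[x] * t.
Proof.
have x0 := conic_x_neq0.
rewrite integral_outsideE => -[P ->]; elim/poly_ind: P => [|P c].
  by exists 0, 0; rewrite coef0 !rmorph0 !horner0 mul0r addr0.
move=> [p [q [q0 E]]].
have [r qE] : exists r, q = r * 'X.
  exists (q %/ 'X); apply/esym/eqP; rewrite divpK // -['X]subr0 -polyC0.
  by rewrite dvdp_XsubCl /root horner_coef0 q0.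
exists (c + rho *: q * 'X + sigma *: r), (p * 'X); split.
  by rewrite coefMX.
rewrite !(rmorphD, rmorphM) /= !map_polyX !map_polyC hornerMXaddC.
rewrite /= 2!hornerD hornerM hornerC E qE !map_polyZ /= !rmorphM /= map_polyX.
rewrite !hornerD !hornerZ !hornerM !hornerX.
have H : y * y = iota rho * x * x + iota sigma by rewrite -expr2 conic_eq; ring.
rewrite -[X in _ * X + _]conic_tx; rewrite -conic_tx in H.
move: t H => s H; rewrite hornerZ hornerM hornerX.
set p0 := (map_poly iota p).[x]; set r0 := (map_poly iota r).[x].
set c0 := (map_poly iota c).[x].
have -> : (p0 + r0 * x * s) * (s * x) + c0 =
          p0 * (s * x) + r0 * (s * x * (s * x)) + c0 by ring.
by rewrite H; ring.
Qed.

(** * Expansions in powers of x with coefficients in k + k t *)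

Section Truncation.
Variables a b : nat -> k.
Let c i := iota (a i) + iota (b i) * t.
Let S n := \sum_(i < n) c i * x ^+ i.

Let vge_c i : vge nu 0 (c i).
Proof.
apply: vgeD => //; first exact: vge_iota.
by rewrite -[0]addr0; apply: (vgeM nuP _ vge_t) => //; apply: vge_iota.
Qed.

Let vge_xn n : vge nu (- n%:Z) (x ^+ n).
Proof.
apply: vge_val; rewrite valuationX //.
by case: C_type_ii => _ [-> _] _ _ _; lia.
Qed.

(** The coefficients are integral and the largest exponent in [S n] is n - 1, whence the bound 1 -
    n. *)
Lemma vge_partial_sum n : vge nu (1 - n%:Z) (S n).
Proof.
elim: n => [|n IHn]; first by left; rewrite /S big_ord0.
rewrite /S big_ord_recr /=; apply: vgeD => //; first by apply: vgeW IHn _; lia.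
have -> : 1 - n.+1%:Z = 0 + - n%:Z by lia.
exact: vgeM.
Qed.

(** By [residue_free], a coefficient of positive valuation is zero. So a pole of order at most m
    kills the coefficients of index above m, one at a time from the top. *)
Lemma truncate_sum m d : vge nu (- m%:Z) (S (m.+1 + d)) ->
  S (m.+1 + d) = S m.+1.
Proof.
elim: d => [|d IHd]; first by rewrite addn0.
rewrite addnS; set n := (m.+1 + d)%N => vS.
have Sn : S n.+1 = S n + c n * x ^+ n by rewrite /S big_ord_recr.
(* The top term is the difference of two sums whose poles have order at most n - 1; dividing by
   [x ^+ n] gives positive valuation. *)
have cn1 : vge nu 1 (c n).
  have -> : c n = c n * x ^+ n * x ^- n.
    by rewrite mulfK // expf_neq0 // conic_x_neq0.
  rewrite -[X in vge nu X](subrK n%:Z).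
  apply: vgeM => //.
    have -> : c n * x ^+ n = S n.+1 - S n by rewrite Sn addrC addKr.
    apply: vgeB => //; last exact: vge_partial_sum.
    by apply: vgeW vS _; rewrite /n; lia.
  apply: vge_val; rewrite valuationV // valuationX //.
  by case: C_type_ii => _ [-> _] _ _ _; lia.
have cn0 : c n = 0.
  by have [an bn] := residue_free cn1; rewrite /c an bn rmorph0 mul0r addr0.
move: Sn; rewrite cn0 mul0r addr0 => Sn.
by rewrite Sn; apply: IHd; rewrite -/n -Sn.
Qed.

End Truncation.

(** The sequences are the coefficients of the full expansion; the pole order only decides where the
    sum may be cut. *)
Lemma conic_expand_trunc z : C z -> exists a b : nat -> k, b 0%N = 0 /\
  forall m, vge nu (- m%:Z) z ->
    z = \sum_(i < m.+1) (iota (a i) + iota (b i) * t) * x ^+ i.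
Proof.
move=> /conic_expand [p [q [q0 zE]]]; exists (nth 0 p), (nth 0 q); split=> // m.
(* With N extra terms the sum covers both polynomials and has the length required by
   [truncate_sum]. *)
set N := maxn (size p) (size q).
have {}zE : z = \sum_(i < m.+1 + N) (iota p`_i + iota q`_i * t) * x ^+ i.
  rewrite zE (@horner_coef_wide _ (m.+1 + N)); last first.
    by rewrite size_map_poly /N; lia.
  rewrite (@horner_coef_wide _ (m.+1 + N)); last first.
    by rewrite size_map_poly /N; lia.
  rewrite mulr_suml -big_split; apply: eq_bigr => i _ /=.
  by rewrite !coef_map /=; ring.
by rewrite zE => /truncate_sum.
Qed.

(** Only the term of index 0 survives, and its t-part vanishes because [b 0 = 0]. *)
Lemma conic_const z : C z -> vge nu 0 z -> exists a, z = iota a.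
Proof.
move=> /conic_expand_trunc [a [b [b0 /(_ 0%N) H]]] /H ->; exists (a 0%N).
by rewrite big_ord1 b0 rmorph0 mul0r addr0 mulr1.
Qed.

Lemma conic_linear z : C z -> vge nu (-1) z ->
  exists a b c, z = iota a + iota b * x + iota c * y.
Proof.
move=> /conic_expand_trunc [a [b [b0 /(_ 1%N) H]]] /H ->.
exists (a 0%N), (a 1%N), (b 1%N); rewrite big_ord_recl big_ord1 /= b0 -conic_tx.
by rewrite rmorph0 /= expr0 expr1; ring.
Qed.

(** A nonzero element of C cannot have positive valuation, since it would be a constant. Applied to
    [z^-1], this makes [z] integral at oo, hence constant. *)
Lemma conic_unit z : C z -> C z^-1 -> exists a, z = iota a.
Proof.
have nonpos u : C u -> u != 0 -> nu u <= 0.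
  move=> Cu u0; case: (lerP (nu u) 0) => // nu0.
  have u0' : vge nu 0 u by right; lia.
  by have [a ua] := conic_const Cu u0'; move: nu0; rewrite ua nu_iota.
move=> Cz Cz'; have [->|z0] := eqVneq z 0; first by exists 0; rewrite rmorph0.
apply: conic_const => //; right.
by have := nonpos _ Cz' (invr_neq0 z0); rewrite valuationV //; lia.
Qed.

(** * The stabilizer of v_* in GL_2(C) *)

Variable pi : K.
Hypothesis nu_pi : nu pi = 1.

Lemma pi_neq0 : pi != 0.
Proof. by apply/eqP => pi0; move: nu_pi; rewrite pi0 valuation0. Qed.

(* The determinant of the matrix ((e, rho z), (z, e)) of the stabilizer of v_*,
   where z = b + c x + d y and e = a + d rho x + c y. *)
Definition stab_norm (a b c d : k) : k :=
  (a ^+ 2 + rho * b ^+ 2) + sigma * (c ^+ 2 + rho * d ^+ 2).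

Let M := affine_mx pi t.

(** Integrality of the conjugate h = M^-1 g M bounds the poles of the entries of g. Removing
    explicit polar parts leaves elements of C without pole, that is, constants, and the relations
    between these are read off in the residue field, where 1 and t are independent over k. *)
Lemma stab_form (g : 'M[K]_2) : (forall i l, C (g i l)) ->
  (forall i l, vge nu 0 ((invmx M *m g *m M) i l)) ->
  exists a b c d : k, g 1 0 = iota b + iota c * x + iota d * y /\
    \det g = iota (stab_norm a b c d).
Proof.
move=> Cg; set h := _ *m M => Oh.
have p0 := pi_neq0; have x0 := conic_x_neq0.
have MU : M \in unitmx by rewrite unitmx_affine.
have E : g *m M = M *m h by rewrite /h !mulmxA mulmxV // mul1mx.
clearbody h.
have Eil i l : (g *m M) i l = (M *m h) i l by rewrite E.
move: (Eil 0 0) (Eil 0 1) (Eil 1 0) (Eil 1 1).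
rewrite !mulmx2E !affine_mxE !(mulr0, mulr1, mul0r, mul1r, addr0, add0r).
move=> E00 E01 E10 E11.
have vg10 : vge nu (-1) (g 1 0).
  have -> : g 1 0 = h 1 0 * pi^-1 by rewrite -E10 mulfK.
  rewrite -[X in vge nu X]add0r; apply: vgeM => //.
  by apply: vge_val; rewrite valuationV // nu_pi.
have [b [c [d g10]]] := conic_linear (Cg 1 0) vg10.
have vs : vge nu 1 (iota sigma * x^-1).
  by rewrite -[1]add0r; apply: (vgeM nuP _ vge_invx) => //; apply: vge_iota.
have vMi z n e : vge nu n z -> vge nu n (iota e * z).
  by move=> vz; rewrite -[n]add0r; apply: vgeM => //; apply: vge_iota.
have w01 z : vge nu 1 z -> vge nu 0 z by move=> vz; apply: vgeW vz _.
have tg10 : t * g 1 0 = iota b * t + iota c * y + iota d * (t * y).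
  by rewrite g10 -conic_tx; ring.
have g00 : g 0 0 = h 0 0 + t * g 1 0.
  by apply: (mulIf p0); rewrite E00 -E10; ring.
(* The polar part of [t * g 1 0]: by [conic_ty] the rest is b t + d sigma / x, which is integral. *)
pose u := iota d * iota rho * x + iota c * y.
have Cu : C u by rewrite /u -rmorphM; apply: conic_linear_integral.
have [a ga] : exists a, g 0 0 - u = iota a.
  apply: conic_const; first exact: (subringB CR (Cg _ _) Cu).
  have -> : g 0 0 - u = h 0 0 + (iota b * t + iota d * (iota sigma * x^-1)).
    by rewrite g00 tg10 conic_ty /u; ring.
  apply: vgeD => //; apply: vgeD => //; apply: vMi; [exact: vge_t | exact: w01].
have [a' ga'] : exists a', g 1 1 + u = iota a'.
  apply: conic_const; first exact: (subringD CR (Cg _ _) Cu).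
  have -> : g 1 1 + u = h 1 1 - (iota b * t + iota d * (iota sigma * x^-1)).
    by rewrite -E11 mulrC tg10 conic_ty /u; ring.
  apply: vgeB => //; apply: vgeD => //; apply: vMi; [exact: vge_t | exact: w01].
have h11 : h 1 1 = iota a' + (iota b * t + iota d * (iota sigma * x^-1)).
  by rewrite -ga' -E11 mulrC tg10 conic_ty /u; ring.
(* The upper right entry is pi h_01 + t h_11 - g_00 t. Its polar part is -s, and [r] collects its
   terms of positive valuation. *)
pose s := iota rho * (iota c * x + iota d * y).
pose r := pi * h 0 1 + (iota b * (iota sigma * x^-1) * x^-1
  + iota d * (iota sigma * x^-1) * t - iota c * (iota sigma * x^-1)).
have vr : vge nu 1 r.
  apply: vgeD => //.
    by rewrite -[1]addr0; apply: vgeM => //; apply: vge_val; rewrite nu_pi.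
  apply: vgeB => //; last exact: vMi.
  apply: vgeD => //.
    rewrite -[1]addr0; apply: (vgeM nuP _ (w01 _ vge_invx)) => //.
    exact: vMi.
  by rewrite -[1]addr0; apply: (vgeM nuP _ vge_t) => //; apply: vMi.
have g01 : g 0 1 + s = iota (a' - a) * t + iota (b * rho) + r.
  have -> : g 0 1 = pi * h 0 1 + t * h 1 1 - g 0 0 * t by rewrite -E01; ring.
  have -> : g 0 0 = iota a + u by rewrite -ga; ring.
  rewrite h11.
  have -> : (iota a + u) * t =
      iota a * t + iota d * iota rho * y + iota c * (t * y).
    by rewrite /u -conic_tx; ring.
  have -> : t * (iota a' + (iota b * t + iota d * (iota sigma / x))) =
      t * iota a' + iota b * t ^+ 2 + iota d * (iota sigma / x) * t by ring.
  by rewrite conic_t2 conic_ty /s /r rmorphB rmorphM; ring.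
have Cs : C s.
  exact: (subringM CR (integral_outside_const _) (conic_linear_integral _ _)).
have [b' gb] : exists b', g 0 1 + s = iota b'.
  apply: conic_const; first exact: (subringD CR (Cg _ _) Cs).
  rewrite g01; apply: vgeD; [by [] | | exact: w01].
  by apply: vgeD; [| exact/vMi/vge_t | exact: vge_iota].
(* This combination of 1 and t equals r, so both of its coefficients vanish: b' = b rho and a =
   a'. *)
have : vge nu 1 (iota (b' - b * rho) + iota (a - a') * t).
  rewrite rmorphB -gb g01 !rmorphB.
  by have -> : forall p q z e f : K, (p - q) * z + e + f - e + (q - p) * z = f
    by move=> *; ring.
move=> /residue_free [/eqP + /eqP]; rewrite !subr_eq0 => /eqP bE /eqP aE.
exists a, b, c, d; split=> //.
have gE00 : g 0 0 = iota a + u by rewrite -ga; ring.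
have gE11 : g 1 1 = iota a - u by rewrite aE -ga'; ring.
have gE01 : g 0 1 = iota rho * iota b - s.
  by rewrite -rmorphM mulrC -bE -gb; ring.
have N (z : K) : - z = z by exact: oppr_pchar2 conic_char z.
rewrite /stab_norm !(rmorphD, rmorphM, rmorphXn) /=.
(* Three sign changes, harmless in characteristic 2, turn the norm into a^2 - rho b^2 - sigma (c^2 -
   rho d^2). With sigma = y^2 - rho x^2 this is the determinant by a polynomial identity over the
   integers. *)
rewrite -[iota rho * iota b ^+ 2]N -[iota sigma * _]N.
rewrite -[iota rho * iota d ^+ 2]N.
rewrite det_mx2E gE00 gE11 gE01 g10 /u /s.
have -> : iota sigma = y ^+ 2 - iota rho * x ^+ 2 by rewrite conic_eq; ring.
by ring.
Qed.

(** An integral lower left entry is constant. Dividing its linear part c x + d y by x then puts c +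
    d t in the maximal ideal, so c = d = 0. *)
Lemma stab_form_const (g : 'M[K]_2) : (forall i l, C (g i l)) ->
  (forall i l, vge nu 0 ((invmx M *m g *m M) i l)) ->
  vge nu 0 (g 1 0) ->
  exists a b, \det g = iota (a ^+ 2 + rho * b ^+ 2).
Proof.
move=> Cg Oh O10; have [a [b [c [d [g10 gdet]]]]] := stab_form Cg Oh.
have [b' gb'] := conic_const (Cg 1 0) O10.
have /residue_free [c0 d0] : vge nu 1 (iota c + iota d * t).
  have x0 := conic_x_neq0.
  have -> : iota c + iota d * t = iota (b' - b) * x^-1.
    by apply: (mulIf x0); rewrite divfK // rmorphB /= -gb' g10 -conic_tx; ring.
  by rewrite -[1]add0r; apply: (vgeM nuP _ vge_invx) => //; apply: vge_iota.
exists a, b; rewrite gdet /stab_norm c0 d0.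
by rewrite expr0n /= mulr0 addr0 mulr0 addr0.
Qed.

Lemma stab_exists a b c d : stab_norm a b c d != 0 ->
  exists g : 'M[K]_2, [/\ GL2 C g, GL2 (valuation_ring nu) (invmx M *m g *m M)
    & \det g = iota (stab_norm a b c d)].
Proof.
move=> N0; have p0 := pi_neq0; have x0 := conic_x_neq0.
have N (z : K) : - z = z by exact: oppr_pchar2 conic_char z.
have D (z : K) : z + z = 0 by exact: addrr_pchar2 conic_char z.
pose z := iota b + iota c * x + iota d * y.
pose e := iota a + iota d * iota rho * x + iota c * y.
pose g : 'M[K]_2 := \matrix_(i, l) nth 0 (nth [::]
  [:: [:: e; iota rho * z]; [:: z; e]] i) l.
have gE : (g 0 0 = e) * (g 0 1 = iota rho * z) * (g 1 0 = z) * (g 1 1 = e).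
  by do ![split]; rewrite mxE.
have gdet : \det g = iota (stab_norm a b c d).
  rewrite /stab_norm !(rmorphD, rmorphM, rmorphXn) /=.
  have -> : iota sigma = y ^+ 2 - iota rho * x ^+ 2 by rewrite conic_eq; ring.
  rewrite det_mx2E !gE.
  (* [Q] is half the difference of the two sides as integral polynomials; its double vanishes in
     characteristic 2. *)
  set Q := iota d ^+ 2 * iota rho ^+ 2 * x ^+ 2 + iota a * iota d * iota rho * x
    + iota a * iota c * y - iota rho * iota b ^+ 2
    - iota rho * iota d ^+ 2 * y ^+ 2
    - iota rho * iota b * (iota c * x + iota d * y).
  by rewrite -[RHS]addr0 -(D Q) /Q /e /z; ring.
(* The matrix [h] below is M^-1 g M written out, with [f] as its upper left entry. *)
pose f := e - t * z.
pose h : 'M[K]_2 := \matrix_(i, l) nth 0 (nth [::]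
  [:: [:: f; (iota rho - t ^+ 2) * z / pi]; [:: z * pi; z * t + e]] i) l.
have hE : (h 0 0 = f) * (h 0 1 = (iota rho - t ^+ 2) * z / pi) *
    (h 1 0 = z * pi) * (h 1 1 = z * t + e).
  by do ![split]; rewrite mxE.
have MU : M \in unitmx by rewrite unitmx_affine.
have gM : g *m M = M *m h.
  apply: mx22P; rewrite !mulmx2E !affine_mxE !gE !hE /f; by field.
have conjE : invmx M *m g *m M = h by rewrite -mulmxA gM mulKmx.
have hdet : \det h = iota (stab_norm a b c d).
  rewrite -gdet; apply: (@mulfI _ (\det M)); first by rewrite det_affine.
  by rewrite -det_mulmx -gM det_mulmx mulrC.
have iN0 : iota (stab_norm a b c d) != 0 by rewrite fmorph_eq0.
have vMi u n q : vge nu n u -> vge nu n (iota q * u).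
  by move=> vu; rewrite -[n]add0r; apply: vgeM => //; apply: vge_iota.
have Clin q c1 d1 : C (iota q + (iota c1 * x + iota d1 * y)).
  apply: (subringD CR); first exact: integral_outside_const.
  exact: conic_linear_integral.
have Cz : C z by rewrite /z -addrA; apply: Clin.
have Ce : C e by rewrite /e -rmorphM -addrA; apply: Clin.
have vz : vge nu (-1) z.
  apply: vgeD => //; last exact/vMi/vge_y.
  by apply: vgeD => //; [apply: vgeW (vge_iota _) _ | exact/vMi/vge_x].
have vf : vge nu 0 f.
  have -> : f = iota a - iota b * t - iota d * (iota sigma * x^-1).
    have -> : f = iota a + iota d * iota rho * x + iota c * (y - t * x) -
        iota b * t - iota d * (t * y) by rewrite /f /e /z; ring.
    by rewrite conic_ty conic_tx; ring.
  apply: vgeB => //; last by apply: vgeW (vMi _ _ _ (vMi _ _ _ vge_invx)) _.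
  by apply: vgeB => //; [exact: vge_iota | exact/vMi/vge_t].
exists g; split=> //.
  apply/(GL2_det CR); split.
  - by rewrite unitmxE gdet unitfE.
  - apply: forall_I2; apply: forall_I2; rewrite gE //.
    exact: (subringM CR (integral_outside_const _)).
  - by rewrite gdet -fmorphV; apply: integral_outside_const.
rewrite conjE; apply/(GL2_det (vge_subring nuP)); split.
- by rewrite unitmxE hdet unitfE.
- apply: forall_I2; apply: forall_I2; rewrite hE /valuation_ring.
  + exact: vf.
  (* The factor rho - t^2 = - sigma / x^2 has a zero of order 2, which absorbs the simple poles of
     [z] and [pi^-1]. *)
  + rewrite conic_t2; have -> : iota rho - (iota rho + iota sigma / x / x) =
      - (iota sigma * (x^-1 * x^-1)) by ring.
    rewrite -[X in vge nu X]/(1 + 1 + -1 + -1 : int).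
    apply: vgeM => //; last by apply: vge_val; rewrite valuationV // nu_pi.
    apply: vgeM => //; apply/vgeN/vMi => //.
    by apply: vgeM => //; apply: vge_invx.
  + rewrite -[X in vge nu X](addNr 1); apply: vgeM => //.
    by apply: vge_val; rewrite nu_pi.
  + have -> : z * t + e = f + (t * z + t * z) by rewrite /f; ring.
    by rewrite D addr0.
- by rewrite hdet -fmorphV; apply: vge_iota.
Qed.

End Conic.

(** * The fields k^2(rho) and k^2(rho, sigma) *)

Section SquareSpan.
Variables (k : fieldType) (rho sigma : k).
Hypothesis char_k : 2%N \in [pchar k].
Hypothesis rho_nonsquare : forall a, a ^+ 2 <> rho.
Hypothesis no_point : forall a b, b ^+ 2 + rho * a ^+ 2 + sigma <> 0.

(** If [r ^+ 2] lies in [S], this span of 1 and r is already the ring S[r]; when [S] contains k^2,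
    it is the field S(r). *)
Definition adjoin_sqrt (S : set k) (r : k) : set k :=
  [set z | exists a b, [/\ S a, S b & z = a + r * b]].

Let sqrD (a b : k) : (a + b) ^+ 2 = a ^+ 2 + b ^+ 2.
Proof. by rewrite sqrrD mulr2n (addrr_pchar2 char_k) addr0. Qed.

Lemma sqr_inj_char2 : injective (fun u : k => u ^+ 2).
Proof.
move=> u u' /= /eqP; rewrite -subr_eq0 (GRing.subr_pchar2 char_k) -sqrD.
by rewrite expf_eq0 /= -(GRing.subr_pchar2 char_k) subr_eq0 => /eqP.
Qed.

Lemma squares_subring : is_subring (squares k).
Proof.
split; first by exists 1; rewrite ?expr1n.
- move=> _ _ [a _ <-] [b _ <-]; exists (a + b) => //.
  by rewrite sqrD (GRing.subr_pchar2 char_k).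
- by move=> _ _ [a _ <-] [b _ <-]; exists (a * b) => //; rewrite exprMn.
Qed.

Lemma adjoin_sqrt_subring (S : set k) (r : k) :
  is_subring S -> S (r ^+ 2) -> is_subring (adjoin_sqrt S r).
Proof.
move=> SR Sr; split.
- exists 1, 0; split; [exact: subring1 | exact: subring0 | ].
  by rewrite mulr0 addr0.
- move=> _ _ [a [b [Sa Sb ->]]] [a' [b' [Sa' Sb' ->]]].
  by exists (a - a'), (b - b'); split; [apply: subringB.. | ring].
- move=> _ _ [a [b [Sa Sb ->]]] [a' [b' [Sa' Sb' ->]]].
  exists (a * a' + r ^+ 2 * (b * b')), (a * b' + b * a'); split; last by ring.
    by apply: (subringD SR); apply: (subringM SR) => //; apply: (subringM SR).
  by apply: (subringD SR); apply: (subringM SR).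
Qed.

Lemma sub_adjoin_sqrt (S : set k) (r : k) : is_subring S ->
  S `<=` adjoin_sqrt S r.
Proof.
move=> SR z Sz; exists z, 0; split=> //; first exact: subring0.
by rewrite mulr0 addr0.
Qed.

Definition k2rho : set k := adjoin_sqrt (squares k) rho.
Definition k2rhosigma : set k := adjoin_sqrt k2rho sigma.

Let sq_mem (a : k) : squares k (a ^+ 2). Proof. by exists a. Qed.

Lemma k2rho_subring : is_subring k2rho.
Proof.
by apply: adjoin_sqrt_subring; [exact: squares_subring | exact: sq_mem].
Qed.

Lemma squares_k2rho : squares k `<=` k2rho.
Proof. exact/sub_adjoin_sqrt/squares_subring. Qed.

Lemma k2rhosigma_subring : is_subring k2rhosigma.
Proof.
apply: adjoin_sqrt_subring; [exact: k2rho_subring | exact/squares_k2rho/sq_mem].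
Qed.

Lemma squares_k2rhosigma : squares k `<=` k2rhosigma.
Proof.
by move=> z /squares_k2rho; apply: sub_adjoin_sqrt; apply: k2rho_subring.
Qed.

Lemma k2rhoP z : k2rho z <-> exists a b, z = a ^+ 2 + rho * b ^+ 2.
Proof.
split=> [[_ [_ [[a _ <-] [b _ <-] ->]]]|[a [b ->]]]; first by exists a, b.
by exists (a ^+ 2), (b ^+ 2).
Qed.

Lemma k2rhosigmaP z :
  k2rhosigma z <-> exists a b c d, z = stab_norm rho sigma a b c d.
Proof.
split=> [[_ [_ [/k2rhoP[a [b ->]] /k2rhoP[c [d ->]] ->]]]|[a [b [c [d ->]]]]].
  by exists a, b, c, d.
exists (a ^+ 2 + rho * b ^+ 2), (c ^+ 2 + rho * d ^+ 2).
by split=> //; apply/k2rhoP; do 2!eexists.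
Qed.

(* An intermediate ring between k^2 and k is a field, since 1/b = b (1/b)^2. *)
Lemma subringV (S : set k) b :
  is_subring S -> squares k `<=` S -> S b -> S b^-1.
Proof.
move=> SR sqS Sb; have [->|b0] := eqVneq b 0.
  by rewrite invr0; apply: subring0.
have -> : b^-1 = b * b^-1 ^+ 2 by rewrite expr2 mulrA divff // mul1r.
by apply: (subringM SR) => //; apply: sqS.
Qed.

Lemma translate_square_inj (S : set k) a f u u' :
  is_subring S -> squares k `<=` S -> ~ S a -> S f ->
  a + u ^+ 2 = f * (a + u' ^+ 2) -> u = u'.
Proof.
move=> SR sqS Sa Sf E; have [f1|f1] := eqVneq f 1.
  by apply: sqr_inj_char2; move: E; rewrite f1 mul1r => /addrI.
have f1' : 1 - f != 0 by rewrite subr_eq0 eq_sym.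
case: Sa; have -> : a = (f * u' ^+ 2 - u ^+ 2) / (1 - f).
  have aE : a = f * (a + u' ^+ 2) - u ^+ 2 by rewrite -E; ring.
  by apply: (mulIf f1'); rewrite divfK // mulrBr mulr1 {1}aE; ring.
apply: (subringM SR).
  by apply: (subringB SR); [apply: (subringM SR) => // |]; apply: sqS.
by apply: subringV => //; apply: (subringB SR) => //; apply: subring1.
Qed.

(** As signs do not matter, a representation sigma = a^2 + rho b^2 is a point of the conic over
    k. *)
Lemma sigma_notin_k2rho : ~ k2rho sigma.
Proof.
move=> /k2rhoP [a [b E]]; apply: (@no_point b a).
by rewrite -E (addrr_pchar2 char_k).
Qed.

Lemma norm_rho_eq0 a b : a ^+ 2 + rho * b ^+ 2 = 0 -> a = 0 /\ b = 0.
Proof.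
move=> E; have [b0|b0] := eqVneq b 0.
  move: E; rewrite b0 expr0n /= mulr0 addr0 => /eqP.
  by rewrite expf_eq0 => /eqP.
case: (@rho_nonsquare (a / b)); apply: (mulIf (expf_neq0 2 b0)).
rewrite expr_div_n divfK ?expf_neq0 //; apply/eqP.
by rewrite -subr_eq0 (GRing.subr_pchar2 char_k) E.
Qed.

(** This is the independence of 1, rho, sigma, rho sigma over k^2: a relation involving sigma would
    express it as a quotient of elements of k^2(rho). *)
Lemma stab_norm_eq0 a b c d : stab_norm rho sigma a b c d = 0 ->
  [/\ a = 0, b = 0, c = 0 & d = 0].
Proof.
rewrite /stab_norm => E; have [cd0|cd0] := eqVneq (c ^+ 2 + rho * d ^+ 2) 0.
  move: E; rewrite cd0 mulr0 addr0 => /norm_rho_eq0 [].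
  by have [] := norm_rho_eq0 cd0.
case: sigma_notin_k2rho.
have -> : sigma = (a ^+ 2 + rho * b ^+ 2) / (c ^+ 2 + rho * d ^+ 2).
  apply: (mulIf cd0); rewrite divfK //; apply/esym/eqP.
  by rewrite -subr_eq0 (GRing.subr_pchar2 char_k) E.
apply: (subringM k2rho_subring); first by apply/k2rhoP; exists a, b.
apply: (subringV k2rho_subring squares_k2rho).
by apply/k2rhoP; exists c, d.
Qed.

(** Scalars from k^2 are written below as squares [u i ^+ 2]; since squaring is additive, linear
    algebra over k^2 becomes linear algebra over k for the square roots. *)
Let B (i : 'I_4) : k := nth 0 [:: 1; rho; sigma; rho * sigma] i.

Let sum_B (u : 'I_4 -> k) : \sum_(i < 4) u i ^+ 2 * B i =
  stab_norm rho sigma (u 0) (u 1) (u (inord 2)) (u (inord 3)).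
Proof.
rewrite !big_ord_recl big_ord0 /B /stab_norm /=.
have -> : lift ord0 ord0 = 1 :> 'I_4 by apply: val_inj.
have -> : lift ord0 (lift ord0 ord0) = inord 2 :> 'I_4.
  by apply: val_inj; rewrite /= inordK.
have -> : lift ord0 (lift ord0 (lift ord0 ord0)) = inord 3 :> 'I_4.
  by apply: val_inj; rewrite /= inordK.
have -> : ord0 = 0 :> 'I_4 by apply: val_inj.
by ring.
Qed.

Let B_free (u : 'I_4 -> k) : \sum_(i < 4) u i ^+ 2 * B i = 0 ->
  forall i, u i = 0.
Proof.
rewrite sum_B => /stab_norm_eq0 [u0 u1 u2 u3] i.
case: i => [[|[|[|[|]]]]] // lt_i.
- by rewrite -[RHS]u0; congr u; apply: val_inj.
- by rewrite -[RHS]u1; congr u; apply: val_inj.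
- by rewrite -[RHS]u2; congr u; apply: val_inj; rewrite /= inordK.
- by rewrite -[RHS]u3; congr u; apply: val_inj; rewrite /= inordK.
Qed.

Let sqr_sum n (u : 'I_n -> k) : (\sum_i u i) ^+ 2 = \sum_i u i ^+ 2.
Proof. by apply: (big_morph (fun z : k => z ^+ 2)); rewrite ?expr0n. Qed.

Lemma has_dim4_k2rhosigma :
  (forall z, k2rhosigma z) -> has_dim (squares k) setT [set 0] 4.
Proof.
move=> full; exists B => // z _.
have [a [b [c [d ->]]]] := (k2rhosigmaP z).1 (full z).
pose u (i : 'I_4) := nth 0 [:: a; b; c; d] i.
exists [ffun i => u i ^+ 2]; split.
  split=> [i|]; first by rewrite ffunE; exists (u i).
  apply/eqP; rewrite subr_eq0; apply/eqP.
  under eq_bigr do rewrite ffunE.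
  by rewrite sum_B /u /= !inordK.
move=> c' [sq'].
have [v vE] : exists v : 'I_4 -> k, forall i, c' i = v i ^+ 2.
  have H i : exists v, v ^+ 2 = c' i by case: (sq' i) => v _ <-; exists v.
  by have [v vE] := choice H; exists v => i; rewrite vE.
move=> /= E; apply/ffunP => i; rewrite ffunE vE; congr (_ ^+ 2).
have /B_free/(_ i)/eqP : \sum_(i < 4) (u i - v i) ^+ 2 * B i = 0.
  rewrite -[RHS]E.
  have -> : stab_norm rho sigma a b c d = \sum_i u i ^+ 2 * B i.
    by rewrite sum_B /u /= !inordK.
  rewrite -sumrB; apply: eq_bigr => l _.
  by rewrite vE -mulrBl !(GRing.subr_pchar2 char_k) sqrD.
by rewrite subr_eq0 => /eqP.
Qed.

(* The coordinates of 1, rho, sigma, rho sigma in a basis over k^2 are the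
   squares of the entries of a matrix, invertible because they are free. *)
Lemma k2rhosigma_full :
  has_dim (squares k) setT [set 0] 4 -> forall z, k2rhosigma z.
Proof.
move=> [e _ He].
have coords z : exists s : 'I_4 -> k, z = \sum_i s i ^+ 2 * e i.
  have [c [[sq /= E] _]] := He z I.
  have H i : exists v, v ^+ 2 = c i by case: (sq i) => v _ <-; exists v.
  have [v vE] := choice H; exists v.
  apply/eqP; rewrite -subr_eq0 -[X in _ == X]E.
  by under eq_bigr do rewrite vE.
have [s sE] := choice (fun i => coords (B i)).
pose T : 'M[k]_4 := \matrix_(i, l) s i l.
have TU : T \in unitmx.
  rewrite -row_free_unit; apply: inj_row_free => v vT.
  apply/rowP => i; rewrite mxE; move: i; apply: B_free.
  under eq_bigr do rewrite sE mulr_sumr.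
  rewrite exchange_big /= big1 // => l _.
  under eq_bigr do rewrite mulrA -exprMn.
  rewrite -mulr_suml -sqr_sum.
  have := congr1 (fun m : 'rV_4 => m 0 l) vT; rewrite !mxE => E.
  rewrite -[X in X ^+ 2 * _](_ : \sum_j v 0 j * T j l = _).
    by rewrite E expr0n mul0r.
  by apply: eq_bigr => i _; rewrite mxE.
(* Squaring the entries of the inverse of [T] inverts the matrix of squared coordinates, so the
   given basis lies in the span of [B]. *)
have eF l : k2rhosigma (e l).
  apply/k2rhosigmaP.
  suff -> : e l = \sum_(i < 4) invmx T l i ^+ 2 * B i.
    by rewrite sum_B; do 4!eexists.
  under eq_bigr do rewrite sE mulr_sumr.
  rewrite exchange_big (bigD1 l) //= [X in _ = _ + X]big1 ?addr0 => [|m ml].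
    under eq_bigr do rewrite mulrA -exprMn.
    rewrite -mulr_suml -sqr_sum.
    have := congr1 (fun m : 'M_4 => m l l) (mulVmx TU); rewrite !mxE eqxx => E.
    rewrite -[X in X ^+ 2 * _](_ : \sum_j invmx T l j * T j l = _).
      by rewrite E expr1n mul1r.
    by apply: eq_bigr => i _; rewrite [T _ _]mxE.
  under eq_bigr do rewrite mulrA -exprMn.
  rewrite -mulr_suml -sqr_sum.
  have := congr1 (fun N : 'M_4 => N l m) (mulVmx TU).
  rewrite !mxE eq_sym (negPf ml) => E.
  rewrite -[X in X ^+ 2 * _](_ : \sum_j invmx T l j * T j m = _).
    by rewrite E expr0n mul0r.
  by apply: eq_bigr => i _; rewrite [T _ _]mxE.
move=> z; have [c ->] := coords z.
apply: (subring_sum k2rhosigma_subring) => i.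
by apply: (subringM k2rhosigma_subring) => //; exact/squares_k2rhosigma/sq_mem.
Qed.

(** On a finite field the injective squaring map would be onto, and [rho] would be a square. *)
Lemma infinite_of_nonsquare : infinite_set [set: k].
Proof.
move=> /finite_seqP [s sE].
have ks z : z \in undup s.
  by rewrite mem_undup; have : [set` s] z by rewrite -sE.
have sqU : uniq [seq u ^+ 2 | u <- undup s].
  by rewrite map_inj_uniq ?undup_uniq //; apply: sqr_inj_char2.
have [|_ /(_ rho)] := @uniq_min_size _ _ (undup s) sqU (fun z _ => ks z).
  by rewrite size_map.
by rewrite ks => /mapP [a _ /esym /rho_nonsquare].
Qed.

Lemma infinite_injective (T : Type) (f : k -> T) (A : set T) :
  injective f -> (forall u, A (f u)) -> infinite_set A.
Proof.
move=> finj Af finA; apply: infinite_of_nonsquare.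
have -> : [set: k] = f @^-1` A by apply/seteqP; split=> // u _; apply: Af.
by apply: finite_preimage => // u u' _ _; apply: finj.
Qed.

End SquareSpan.

(** * Stabilizers, orbits and determinants on the tree *)

Section QuotientTree.
Variables (k K : fieldType) (iota : {rmorphism k -> K}) (nu : K -> int).
Variables (pi x y : K) (rho sigma : k).
Variables (E : fieldType) (j : {rmorphism K -> E}) (w : E -> int).
Hypothesis char_k : 2%N \in [pchar k].
Hypothesis nu_place : places iota nu.
Hypothesis C_type_ii : type_ii iota nu x y rho sigma.
Hypothesis nu_pi : nu pi = 1.
Hypothesis wP : is_valuation w.
Hypothesis w_j : forall a, w (j a) = nu a.

Let C := integral_outside iota nu.
Let t := y / x.
Let M := affine_mx pi t.
Let H := ZGL2O w.
Let G := embed j (GL2 C).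
Let Gamma := embed j (SL2 C).
Let vs := vstar pi j w t.
Let v0 := vpath pi j w 0.
Let CR : is_subring C := @integral_outside_subring _ _ iota nu.
Let nuP : is_valuation nu. Proof. by case: nu_place. Qed.
Let MU : M \in unitmx. Proof. by rewrite unitmx_affine (pi_neq0 nu_place). Qed.

Lemma vstarE : vs = left_coset H (map_mx j M).
Proof. by rewrite /vs /vstar /vertex map_affine. Qed.

Lemma v0E : v0 = left_coset H (map_mx j 1%:M).
Proof.
rewrite /v0 /vpath /vertex expr0 invr1 -map_affine; congr left_coset.
by congr (map_mx j _); apply: mx22P; rewrite !affine_mxE !mxE.
Qed.

Lemma vge_j n z : vge w n (j z) -> vge nu n z.
Proof.
move=> [/eqP|]; first by rewrite fmorph_eq0 => /eqP ->; left.
by rewrite w_j; right.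
Qed.

Lemma j_vge n z : vge nu n z -> vge w n (j z).
Proof. by move=> [->|?]; [left; rewrite rmorph0 | right; rewrite w_j]. Qed.

Lemma GL2_j g :
  GL2 (valuation_ring nu) g -> GL2 (valuation_ring w) (map_mx j g).
Proof.
move=> [gU Og Og']; split; rewrite ?map_unitmx // => i l.
  by rewrite mxE; apply/j_vge/Og.
by rewrite -map_invmx mxE; apply/j_vge/Og'.
Qed.

Lemma act_coset_eq (g P Q : 'M[K]_2) :
  g \in unitmx -> P \in unitmx -> Q \in unitmx ->
  act (map_mx j g) (left_coset H (map_mx j P)) = left_coset H (map_mx j Q) <->
  H (map_mx j (invmx Q *m g *m P)).
Proof.
move=> gU PU QU; rewrite act_coset -map_mxM coset_eq //;
  rewrite ?map_unitmx ?unitmx_mul ?gU //.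
by rewrite -map_invmx -map_mxM mulmxA.
Qed.

(** Fixing the vertex puts the conjugate of g only in Z GL_2(O_oo); the determinant of valuation 0
    forces the scalar to be a unit. *)
Lemma fix_integral (g P : 'M[K]_2) : nu (\det g) = 0 ->
  g \in unitmx -> P \in unitmx ->
  act (map_mx j g) (left_coset H (map_mx j P)) = left_coset H (map_mx j P) ->
  forall i l, vge nu 0 ((invmx P *m g *m P) i l).
Proof.
move=> gdet gU PU /(act_coset_eq gU PU PU) /(ZGL2O_val wP) [n []].
rewrite det_map_mx w_j !det_mulmx det_inv mulrAC mulVf ?mul1r; last first.
  by rewrite -unitfE -unitmxE.
rewrite gdet => n0 + i l => /(_ i l); rewrite mxE => /vge_j.
by have -> : n = 0 by lia.
Qed.

Lemma GL2C_det g : GL2 C g -> exists2 d, d != 0 & \det g = iota d.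
Proof.
move=> Cg; have /(GL2_det CR)[gU _ Cd'] := Cg.
have [_ Cg' _] := Cg; have Cd := subring_det CR Cg'.
have [d dE] := conic_unit char_k nu_place C_type_ii Cd Cd'.
exists d => //; move: gU; rewrite unitmxE unitfE dE.
by rewrite fmorph_eq0.
Qed.

Lemma GL2C_nu_det g : GL2 C g -> nu (\det g) = 0.
Proof. by move=> /GL2C_det [d _ ->]; apply: nu_iota. Qed.

Lemma stabilizer_vstar_det g : GL2 C g -> act (map_mx j g) vs = vs ->
  exists2 d, k2rhosigma rho sigma d & \det g = iota d.
Proof.
move=> Cg; have [gU Cg' _] := Cg; rewrite vstarE.
move=> /(fix_integral (GL2C_nu_det Cg) gU MU) Og.
have [a [b [c [d [_ ->]]]]] :=
  stab_form char_k nu_place C_type_ii nu_pi Cg' Og.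
by eexists; last reflexivity; apply/k2rhosigmaP; exists a, b, c, d.
Qed.

(** The vertex v_0 is the coset of the identity, so fixing it makes the entries of g themselves
    integral at oo, in particular the lower left one. *)
Lemma stabilizer_edge_det g : GL2 C g -> act (map_mx j g) vs = vs ->
  act (map_mx j g) v0 = v0 -> exists2 d, k2rho rho d & \det g = iota d.
Proof.
move=> Cg; have [gU Cg' _] := Cg; rewrite vstarE v0E.
move=> /(fix_integral (GL2C_nu_det Cg) gU MU) Og.
move=> /(fix_integral (GL2C_nu_det Cg) gU (unitmx1 _ _)) /(_ 1 0).
rewrite invmx1 mul1mx mulmx1 => O10.
have [a [b ->]] :=
  stab_form_const char_k nu_place C_type_ii nu_pi Cg' Og O10.
by eexists; last reflexivity; apply/k2rhoP; exists a, b.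
Qed.

Lemma stabilizer_vstar_exists d : d != 0 -> k2rhosigma rho sigma d ->
  exists g, [/\ GL2 C g, act (map_mx j g) vs = vs & \det g = iota d].
Proof.
move=> d0 /k2rhosigmaP [a [b [c [e dE]]]].
have N0 : stab_norm rho sigma a b c e != 0 by rewrite -dE.
have [g [Cg Og gdet]] := stab_exists char_k nu_place C_type_ii nu_pi N0.
exists g; split; rewrite ?gdet ?dE // vstarE.
have [gU _ _] := Cg; apply/act_coset_eq => //.
by apply: (ZGL2O_GL2); apply: GL2_j.
Qed.

(* The parity of nu(det) on the class of a vertex is G-invariant. *)
Lemma vstar_neq_v0 g : GL2 C g -> act (map_mx j g) vs <> v0.
Proof.
move=> Cg; have [gU _ _] := Cg; rewrite vstarE v0E.
move=> /(act_coset_eq gU MU (unitmx1 _ _)) /(ZGL2O_val wP) [n []].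
rewrite invmx1 mul1mx det_map_mx w_j det_mulmx det_affine.
have d0 : \det g != 0 by rewrite -unitfE -unitmxE.
have p0 := pi_neq0 nu_place nu_pi.
rewrite (valuationM nuP d0 p0). rewrite GL2C_nu_det // nu_pi; lia.
Qed.

Lemma SL2C_GL2 g : SL2 C g -> GL2 C g.
Proof. by move=> /(SL2_GL2 CR) []. Qed.

Lemma SL2C_M g h : SL2 C g -> SL2 C h -> SL2 C (g *m h).
Proof.
move=> /(SL2_GL2 CR) [Cg dg] /(SL2_GL2 CR) [Ch dh]; apply/(SL2_GL2 CR).
by split; [apply: (GL2_M CR) | rewrite det_mulmx dg dh mulr1].
Qed.

Lemma SL2C_div g h : GL2 C g -> GL2 C h -> \det g = \det h ->
  SL2 C (g *m invmx h).
Proof.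
move=> Cg Ch dgh; apply/(SL2_GL2 CR); split; first exact/(GL2_M CR Cg)/GL2_V.
rewrite det_mulmx det_inv dgh divff // -unitfE -unitmxE.
by case: Ch.
Qed.

Lemma orbit_eqP V W : vertex_orbit Gamma V = vertex_orbit Gamma W <->
  exists2 g, SL2 C g & V = act (map_mx j g) W.
Proof.
split=> [VW|[g Cg ->]].
  have : vertex_orbit Gamma V V.
    exists (map_mx j 1%:M); last by rewrite map_mx1 act1.
    exists 1%:M => //; apply/(SL2_GL2 CR).
    by rewrite det1; split=> //; apply: GL2_1.
  by rewrite VW => -[_ [g Cg <-] <-]; exists g.
have [gU _ _] := SL2C_GL2 Cg.
apply/seteqP; split=> _ [_ [h Ch <-] <-].
  exists (map_mx j (h *m g)); first by exists (h *m g) => //; apply: SL2C_M.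
  by rewrite map_mxM actM.
exists (map_mx j (h *m invmx g)).
  exists (h *m invmx g) => //; apply: SL2C_M => //.
  have [CG dg] := (SL2_GL2 CR g).1 Cg.
  rewrite -[invmx g]mul1mx; apply: SL2C_div => //; first exact: GL2_1.
  by rewrite det1.
by rewrite actM -map_mxM -mulmxA mulVmx // mulmx1.
Qed.

(** The quotient g h^-1 has determinant 1 and carries one vertex to the other. *)
Lemma orbit_det g h V : GL2 C g -> GL2 C h -> \det g = \det h ->
  vertex_orbit Gamma (act (map_mx j g) V) =
  vertex_orbit Gamma (act (map_mx j h) V).
Proof.
move=> Cg Ch dgh; apply/orbit_eqP; exists (g *m invmx h); first exact: SL2C_div.
have [hU _ _] := Ch.
by rewrite actM -map_mxM -mulmxA mulVmx // mulmx1.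
Qed.

Lemma vertices_above_vstarP X : vertices_above w Gamma G vs X <->
  exists2 g, GL2 C g & X = vertex_orbit Gamma (act (map_mx j g) vs).
Proof.
have C1 : GL2 C 1%:M by apply: GL2_1.
have S1 : SL2 C 1%:M by apply/(SL2_GL2 CR); rewrite det1.
split=> [[[V _ <-] E1]|[g Cg ->]].
  have : phi G (vertex_orbit Gamma V) V.
    exists (map_mx j 1%:M); first by exists 1%:M.
    exists V; last by rewrite map_mx1 act1.
    by exists (map_mx j 1%:M); [exists 1%:M | rewrite map_mx1 act1].
  by rewrite E1 => -[_ [g Cg <-] <-]; exists g.
have [gU _ _] := Cg.
split.
  exists (act (map_mx j g) vs) => //.
  exists (map_mx j (g *m M)); first by rewrite /= map_unitmx unitmx_mul gU.
  by rewrite vstarE act_coset map_mxM.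
apply/seteqP; split=> V.
  move=> [_ [h Ch <-] [_ [_ [s Cs <-] <-] <-]].
  exists (map_mx j (h *m s *m g)); last by rewrite !map_mxM !actM.
  by exists (h *m s *m g) => //; do 2!apply: (GL2_M CR) => //; apply: SL2C_GL2.
move=> [_ [h Ch <-] <-].
exists (map_mx j (h *m invmx g)).
  by exists (h *m invmx g) => //; apply: (GL2_M CR) => //; apply: GL2_V.
exists (act (map_mx j g) vs).
  by exists (map_mx j 1%:M); [exists 1%:M | rewrite map_mx1 act1].
by rewrite actM -map_mxM -mulmxA mulVmx // mulmx1.
Qed.

(** If r in SL_2(C) carries h v_* to g v_*, then g^-1 r h fixes v_* and has determinant det h / det
    g. *)
Lemma orbit_vstar_det g h : GL2 C g -> GL2 C h ->
  vertex_orbit Gamma (act (map_mx j g) vs) =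
    vertex_orbit Gamma (act (map_mx j h) vs) ->
  exists2 f, k2rhosigma rho sigma f & \det h = iota f * \det g.
Proof.
move=> Cg Ch /orbit_eqP [r Sr E1].
have Cr := SL2C_GL2 Sr; have [_ rdet] := (SL2_GL2 CR r).1 Sr.
have [gU _ _] := Cg.
have Cq : GL2 C (invmx g *m (r *m h)).
  by apply: (GL2_M CR); [apply: GL2_V | apply: (GL2_M CR)].
have [|f Ff E2] := stabilizer_vstar_det Cq.
  rewrite map_mxM -actM map_mxM -actM -E1 actM -map_mxM mulVmx //.
  by rewrite map_mx1 act1.
exists f => //; rewrite -E2 !det_mulmx det_inv rdet mul1r mulrAC.
by rewrite mulVf ?mul1r // -unitfE -unitmxE.
Qed.

(** The diagonal matrix diag(d, 1) serves. It yields both elements of G of any prescribed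
    determinant and the uniqueness of the vertex above v_0. *)
Lemma stabilizer_v0_exists (d : k) : d != 0 ->
  exists g, [/\ GL2 C g, \det g = iota d & act (map_mx j g) v0 = v0].
Proof.
move=> d0.
have gdet : \det (affine_mx (iota d) 0) = iota d by rewrite det_affine.
have gU : affine_mx (iota d) 0 \in unitmx by rewrite unitmx_affine fmorph_eq0.
exists (affine_mx (iota d) 0); split=> //.
  apply/(GL2_det CR); split=> //.
    apply: forall_I2; apply: forall_I2; rewrite affine_mxE.
    - exact: integral_outside_const.
    - exact: subring0.
    - exact: subring0.
    - exact: subring1.
  by rewrite gdet -fmorphV; apply: integral_outside_const.
rewrite v0E; apply/act_coset_eq; rewrite ?unitmx1 //.
rewrite invmx1 mul1mx mulmx1; apply/ZGL2O_GL2/GL2_j.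
apply/(GL2_det (vge_subring nuP)); split=> //.
  apply: forall_I2; apply: forall_I2; rewrite affine_mxE.
  - exact: vge_iota.
  - exact: vge0.
  - exact: vge0.
  - by right; rewrite valuation1.
by rewrite gdet -fmorphV; apply: vge_iota.
Qed.

Lemma adjacent_act g V W : g \in unitmx -> adjacent nu pi j w V W ->
  adjacent nu pi j w (act (map_mx j g) V) (act (map_mx j g) W).
Proof.
move=> gU [g1 [g2 [g1U g2U -> -> E1]]].
exists (map_mx j g *m g1), (map_mx j g *m g2).
rewrite !unitmx_mul map_unitmx gU g1U g2U !act_coset; split=> //.
have -> // : invmx (map_mx j g *m g2) *m (map_mx j g *m g1) = invmx g2 *m g1.
have jU : map_mx j g \in unitmx by rewrite map_unitmx.
have U : map_mx j g *m g2 \in unitmx by rewrite unitmx_mul jU.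
rewrite -{1}(mulKVmx g2U g1) (mulmxA (map_mx j g)) mulKmx //.
Qed.

Lemma adjacent_vstar_v0 : adjacent nu pi j w vs v0.
Proof.
exists (map_mx j M), 1%:M; rewrite map_unitmx MU unitmx1.
split=> //; first exact: vstarE.
  by rewrite v0E map_mx1.
left; exists t; first exact: (vge_t nu_place C_type_ii).
exists 1%:M; first exact: (ZGL2O_1 wP).
by rewrite invmx1 mul1mx mulmx1 map_affine.
Qed.

Lemma orbit_v0 g : GL2 C g ->
  vertex_orbit Gamma (act (map_mx j g) v0) = vertex_orbit Gamma v0.
Proof.
move=> Cg; have [d d0 gd] := GL2C_det Cg.
have [h [Ch hd hv]] := stabilizer_v0_exists d0.
by rewrite (orbit_det v0 Cg Ch) ?hv // gd hd.
Qed.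

(** An element r of Gamma that matches the two edges cannot exchange the two kinds of end points, by
    [vstar_neq_v0]. Hence it fixes g v_* and sends g s' v_0 to g s v_0, so that (g s)^-1 r g s'
    stabilizes the edge from v_* to v_0. *)
Lemma edge_orbit_det g s s' : GL2 C g -> GL2 C s -> GL2 C s' ->
  act (map_mx j s) vs = vs -> act (map_mx j s') vs = vs ->
  edge_orbit Gamma [set act (map_mx j g) vs; act (map_mx j (g *m s)) v0] =
  edge_orbit Gamma [set act (map_mx j g) vs; act (map_mx j (g *m s')) v0] ->
  exists2 f, k2rho rho f & \det s = iota f * \det s'.
Proof.
move=> Cg Cs Cs' sv sv' E1.
have [gU _ _] := Cg; have [sU _ _] := Cs; have [sU' _ _] := Cs'.
set e := [set _; _] in E1.
have : edge_orbit Gamma e e.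
  exists (map_mx j 1%:M).
    exists 1%:M => //; apply/(SL2_GL2 CR).
    by rewrite det1; split=> //; apply: GL2_1.
  by rewrite map_mx1 /act_edge; apply/seteqP; split=> [_ [V eV <-]|V eV];
    [|exists V]; rewrite ?act1.
rewrite E1 => -[_ [r Sr <-]].
rewrite act_pair (actM _ _ vs) (actM _ _ v0) -!map_mxM /e => E2.
have Cr := SL2C_GL2 Sr; have [_ rdet] := (SL2_GL2 CR r).1 Sr.
have [rU _ _] := Cr.
have cancel a b V W : a \in unitmx ->
    act (map_mx j a) V = act (map_mx j b) W ->
    act (map_mx j (invmx a *m b)) W = V.
  move=> aU aVbW; rewrite map_mxM -actM -aVbW actM -map_mxM mulVmx //.
  by rewrite map_mx1 act1.
have GM a b : GL2 C a -> GL2 C b -> GL2 C (a *m b) by apply: (GL2_M CR).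
have GV a : GL2 C a -> GL2 C (invmx a) by apply: GL2_V.
have Evs : act (map_mx j (r *m g)) vs = act (map_mx j g) vs.
  have : [set act (map_mx j g) vs; act (map_mx j (g *m s)) v0]
      (act (map_mx j (r *m g)) vs) by rewrite -E2; left.
  case=> [//|E3]; case: (@vstar_neq_v0 (invmx (g *m s) *m (r *m g))).
    by do ?[apply: (GM) => // | apply: (GV) => //].
  by apply: (cancel); rewrite ?unitmx_mul ?gU.
have Ev0 : act (map_mx j (r *m (g *m s'))) v0 = act (map_mx j (g *m s)) v0.
  have : [set act (map_mx j g) vs; act (map_mx j (g *m s)) v0]
      (act (map_mx j (r *m (g *m s'))) v0) by rewrite -E2; right.
  case=> [E3|//]; case: (@vstar_neq_v0 (invmx (r *m (g *m s')) *m g)).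
    by do ?[apply: (GM) => // | apply: (GV) => //].
  by apply: (cancel); rewrite ?unitmx_mul ?rU ?gU.
pose q := invmx (g *m s) *m (r *m (g *m s')).
have Cq : GL2 C q by do ?[apply: (GM) => // | apply: (GV) => //].
have qv0 : act (map_mx j q) v0 = v0.
  by apply: (cancel); rewrite ?Ev0 // unitmx_mul gU.
have qvs : act (map_mx j q) vs = vs.
  apply: (cancel); first by rewrite unitmx_mul gU.
  by rewrite mulmxA [in RHS]map_mxM -actM sv' Evs map_mxM -actM sv.
have [f Ff qf] := stabilizer_edge_det Cq qvs qv0.
have q0 : f != 0 by rewrite -(fmorph_eq0 iota) -qf -unitfE -unitmxE; case: Cq.
have ff0 : iota f != 0 by rewrite fmorph_eq0.
(* The determinant of [q] is det s' / det s, hence the inverse. *)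
exists f^-1.
  exact: (subringV (k2rho_subring _ char_k) (squares_k2rho _ char_k) Ff).
apply: (mulfI ff0); rewrite fmorphV mulVKf // -qf /q.
have g0 : \det g != 0 by rewrite -unitfE -unitmxE.
have s0 : \det s != 0 by rewrite -unitfE -unitmxE.
rewrite det_mulmx det_inv !det_mulmx rdet; field.
by rewrite g0 s0.
Qed.

End QuotientTree.

(** * Counting the vertices above v_* and the edges from them to v_0 *)

Theorem lemma3p8 (k K : fieldType) (iota : {rmorphism k -> K})
    (nu : K -> int) (pi x y : K) (rho sigma : k)
    (Kinf : fieldType) (j : {rmorphism K -> Kinf}) (nuinf : Kinf -> int)
    (char_k : 2%N \in [pchar k])
    (K_function_field : is_function_field iota)
    (K_constants : full_constant_field iota)
    (K_genus : has_genus iota 0)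
    (K_nonrational : ~ rational iota)
    (nu_place : places iota nu)
    (nu_degree : place_degree iota nu = 2%N)
    (nu_pi : nu pi = 1)
    (Kinf_completion : is_completion nu j nuinf)
    (C_type_ii : type_ii iota nu x y rho sigma) :
  let C := integral_outside iota nu in
  let G := embed j (GL2 C) in
  let Gamma := embed j (SL2 C) in
  let t := y / x in
  let above_vstar := vertices_above nuinf Gamma G (vstar pi j nuinf t) in
  let v0 := vertex_orbit Gamma (vpath pi j nuinf 0) in
  let degree_eq_4 := has_dim (squares k) setT [set 0] 4 in
  let degree_gt_4 := dim_gt (squares k) setT [set 0] 4 in
  [/\ degree_eq_4 -> exists! X, above_vstar X,
      degree_gt_4 -> infinite_set above_vstar &
      degree_eq_4 \/ degree_gt_4 ->
        forall X, above_vstar X ->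
          infinite_set (edges_between nu pi j nuinf Gamma X v0)].
Proof.
move=> C G Gamma t above_vstar v0 degree_eq_4 degree_gt_4.
have [wP w_j _ _] := Kinf_completion.
have [_ _ _ _ [rho_ns no_point]] := C_type_ii.
pose vs := vstar pi j nuinf t.
have aboveE := vertices_above_vstarP x y j nuinf nu_place nu_pi.
have vstar_ex d :=
  @stabilizer_vstar_exists _ _ _ _ _ _ _ _ _ _ j _
    char_k nu_place C_type_ii nu_pi wP w_j d.
have vstar_det g h :=
  @orbit_vstar_det _ _ _ _ _ _ _ _ _ _ j _
    char_k nu_place C_type_ii nu_pi wP w_j g h.
have edge_det g s s' :=
  @edge_orbit_det _ _ _ _ _ _ _ _ _ _ j _
    char_k nu_place C_type_ii nu_pi wP w_j g s s'.
have C1 : GL2 C 1%:M by apply/GL2_1/integral_outside_subring.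
have FR := k2rhosigma_subring rho sigma char_k.
have sqF := @squares_k2rhosigma _ rho sigma char_k.
split.
- move=> /(k2rhosigma_full char_k rho_ns no_point) full.
  exists (vertex_orbit Gamma vs); split.
    by apply/aboveE; exists 1%:M => //; rewrite map_mx1 act1.
  move=> X /aboveE [g Cg ->].
  (* Every determinant now occurs in the stabilizer of v_*, so [g] can be replaced by an element
     fixing v_* with the same determinant. *)
  have [d d0 gd] := GL2C_det char_k nu_place C_type_ii Cg.
  have [s [Cs sv sd]] := vstar_ex d d0 (full d).
  have /(orbit_det j vs Cs Cg) <- : \det s = \det g by rewrite sd gd.
  by rewrite sv.
- move=> gt4.
  have [a Fa] : exists a, ~ k2rhosigma rho sigma a.
    apply/existsNP => full.
    by have := gt4 _ (has_dim4_k2rhosigma char_k rho_ns no_point full).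
  have au0 u : a + u ^+ 2 != 0.
    apply/eqP => /eqP; rewrite addr_eq0 (oppr_pchar2 char_k) => /eqP aE.
    by apply/Fa/sqF; exists u.
  (* The matrices [D u] have determinants a + u^2, pairwise distinct modulo the multiplicative group
     of k^2(rho, sigma). *)
  have [D DP] := choice (fun u =>
    stabilizer_v0_exists pi nu_place wP w_j (au0 u)).
  apply: (infinite_injective char_k rho_ns
    (f := fun u => vertex_orbit Gamma (act (map_mx j (D u)) vs))); last first.
    by move=> u; apply/aboveE; exists (D u) => //; have [] := DP u.
  move=> u u' /= E1; have [Cu du _] := DP u; have [Cu' du' _] := DP u'.
  have [f Ff] := vstar_det _ _ Cu Cu' E1.
  rewrite du du' -rmorphM => /fmorph_inj E2.
  by apply/esym; apply: (translate_square_inj char_k FR sqF Fa Ff E2).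
move=> _ X /aboveE [g Cg ->].
(* Here sigma takes the place of [a]: the elements sigma + u^2 are determinants of elements [S u]
   fixing v_*, and they are distinct modulo the multiplicative group of k^2(rho). *)
have su0 u : sigma + u ^+ 2 != 0.
  apply/eqP => E1; apply: (no_point 0 u).
  by rewrite expr0n mulr0 addr0 addrC.
have Fsu u : k2rhosigma rho sigma (sigma + u ^+ 2).
  apply/k2rhosigmaP; exists u, 0, 1, 0.
  by rewrite /stab_norm !expr0n expr1n /=; ring.
have [S SP] := choice (fun u =>
  vstar_ex _ (su0 u) (Fsu u)).
apply: (infinite_injective char_k rho_ns (f := fun u => edge_orbit Gamma
  [set act (map_mx j g) vs; act (map_mx j (g *m S u)) (vpath pi j nuinf 0)])).
  move=> u u' /= E1; have [Cu vu du] := SP u; have [Cu' vu' du'] := SP u'.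
  have [f Ff] := edge_det _ _ _ Cg Cu Cu' vu vu' E1.
  rewrite du du' -rmorphM => /fmorph_inj E2.
  apply: (translate_square_inj char_k (k2rho_subring rho char_k)
    (@squares_k2rho _ rho char_k) _ Ff E2).
  exact: (sigma_notin_k2rho char_k no_point).
move=> u; have [Cu vu _] := SP u; have [gU _ _] := Cg; have [uU _ _] := Cu.
have CgS : GL2 C (g *m S u).
  by apply: (GL2_M (@integral_outside_subring _ _ iota nu)).
exists (act (map_mx j g) vs), (act (map_mx j (g *m S u)) (vpath pi j nuinf 0)).
split=> //; last first.
  by rewrite (orbit_v0 pi char_k nu_place C_type_ii wP w_j CgS).
(* As [S u] fixes v_*, the pair is the translate by g (S u) of the edge from v_* to v_0. *)
rewrite -[vs]vu actM -map_mxM; apply: adjacent_act.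
  by rewrite unitmx_mul gU.
exact: (adjacent_vstar_v0 j nu_place C_type_ii nu_pi wP).
Qed.
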